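(* Let $(X,\mathcal{A})$ be a measurable space and let $\mu\colon\mathcal{A}\to[0,\infty]$ be a nonadditive measure. The following assertions are equivalent. (i) $\mu$ is monotone autocontinuous from below. (ii) For any $\{f_n\}_{n\in\mathbb{N}}\subset\mathcal{F}_0^+(X)$ and $f\in\mathcal{F}_0^+(X)$, if they satisfy (a) $f_n(x)\le f_{n+1}(x)\le f(x)$ for every $x\in X$ and $n\in\mathbb{N}$, (b) $f_n\to f$ $\mu$-almost uniformly, then $\mathrm{Sh}(\mu,f_n)\uparrow\mathrm{Sh}(\mu,f)$. (iii) For any $\{f_n\}_{n\in\mathbb{N}}\subset\mathcal{F}_0^+(X)$ and $f\in\mathcal{F}_0^+(X)$, if $f_n\to f$ $\mu$-almost uniformly, then $$\mathrm{Sh}(\mu,f)\le\liminf_{n\to\infty}\mathrm{Sh}(\mu,f_n).$$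
   Context: $X$ is a nonempty set and $\mathcal{A}$ is a $\sigma$-field of subsets of $X$. A nonadditive measure is a set function $\mu\colon\mathcal{A}\to[0,\infty]$ with $\mu(\emptyset)=0$ and $\mu(A)\le\mu(B)$ whenever $A,B\in\mathcal{A}$, $A\subset B$. $\mathcal{F}_0^+(X)$ is the set of all $\mathcal{A}$-measurable functions $X\to[0,\infty)$. Monotone autocontinuous from below: $\mu(A\setminus B_n)\to\mu(A)$ whenever $A,B_n\in\mathcal{A}$, $\{B_n\}_{n\in\mathbb{N}}$ is nonincreasing, and $\mu(B_n)\to 0$. $f_n\to f$ $\mu$-almost uniformly: for any $\varepsilon>0$ there is $E_\varepsilon\in\mathcal{A}$ with $\mu(E_\varepsilon)<\varepsilon$ such that $f_n\to f$ uniformly on $X\setminus E_\varepsilon$. Shilkret integral: $\mathrm{Sh}(\mu,f):=\sup_{t\in[0,\infty)}t\,\mu(\{f>t\})\in[0,\infty]$ for $f\in\mathcal{F}_0^+(X)$, with the convention $0\cdot\infty=0$. For $a_n,a\in[-\infty,\infty]$, $a_n\uparrow a$ means that $\{a_n\}$ is nondecreasing and $a_n\to a$. *)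

(* Defs.v *)
From HB Require Import structures.
From mathcomp Require Export all_boot all_order all_algebra.
From mathcomp Require Export all_classical all_reals all_analysis.

Set Implicit Arguments.
Unset Strict Implicit.
Unset Printing Implicit Defensive.

Import Order.TTheory GRing.Theory Num.Theory.
Import numFieldNormedType.Exports.

Local Open Scope classical_set_scope.
Local Open Scope ring_scope.
Local Open Scope ereal_scope.

Section definitions.
Context {d : measure_display} {X : measurableType d} {R : realType}.
Implicit Types (mu : set X -> \bar R) (f : X -> R).

(* A set function on the sigma-field is encoded by a total function on
   [set X]; its values outside the sigma-field are unconstrained and never
   used. *)
Definition nonadditive_measure mu : Prop :=
  [/\ mu set0 = 0,
      forall A, measurable A -> 0 <= mu A &
      forall A B, measurable A -> measurable B -> A `<=` B -> mu A <= mu B].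

Definition monotone_autocontinuous_from_below mu : Prop :=
  forall (A : set X) (B : (set X)^nat),
    measurable A -> (forall n, measurable (B n)) ->
    nonincreasing_seq B ->
    mu (B n) @[n --> \oo] --> 0 ->
    mu (A `\` B n) @[n --> \oo] --> mu A.

Definition nonneg_measurable f : Prop :=
  measurable_fun [set: X] f /\ forall x, (0 <= f x)%R.

Definition almost_uniform_cvg mu (f_ : (X -> R)^nat) f : Prop :=
  forall eps : R, (0 < eps)%R ->
    exists E : set X, [/\ measurable E, mu E < eps%:E &
      {uniform ~` E, f_ @ \oo --> f}].

(* [mule] satisfies [0 * +oo = 0]. *)
Definition shilkret mu f : \bar R :=
  ereal_sup [set t%:E * mu [set x | (t < f x)%R] | t in [set t : R | (0 <= t)%R]].

Definition increases_to (a : (\bar R)^nat) (l : \bar R) : Prop :=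
  nondecreasing_seq a /\ a @ \oo --> l.

End definitions.

(* Main.v *)
(* The implications run (i) => (iii) => (ii) => (i).
   For (i) => (iii), choose a nonincreasing sequence [B k] with [mu (B k)]
   tending to [0] such that [f_ n] tends to [f] uniformly off each [B k]. If
   [0 <= s < t], then [{f > t} \ B k] is contained in [{f_ n > s}] for large [n],
   so [s * mu ({f > t} \ B k) <= limn_einf (Sh (f_ n))]; let [k] tend to
   infinity, then let [s] tend to [t]. For (iii) => (ii), use that [Sh] is
   monotone in [f]. For (ii) => (i), apply (ii) to the indicators of
   [A \ B n] and [A], since [Sh \1_A = mu A]. *)
Require Import Defs.
From mathcomp Require Import all_boot all_order all_algebra.
From mathcomp Require Import all_classical all_reals all_analysis.

Import Order.TTheory GRing.Theory Num.Theory.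
Import numFieldNormedType.Exports.

Local Open Scope classical_set_scope.
Local Open Scope ring_scope.
Local Open Scope ereal_scope.

Set Implicit Arguments.
Unset Strict Implicit.
Unset Printing Implicit Defensive.

(** Passes from the uniform topology to the epsilon form: the functions within [e] of [f] on [A]
    form a neighbourhood of [f]. *)
Lemma uniform_cvg_near_lt (T : choiceType) (R : realType) (A : set T)
    (f_ : (T -> R)^nat) (f : T -> R) (e : R) :
  {uniform A, f_ @ \oo --> f} -> (0 < e)%R ->
  \forall n \near \oo, forall x, A x -> (`|f x - f_ n x| < e)%R.
Proof.
move=> f_f e0; apply: (f_f [set g | forall x, A x -> (`|f x - g x| < e)%R]).
apply/uniform_nbhs; exists [set xy | ball xy.1 e xy.2]; split => //.
by rewrite -entourage_from_ballE; exists e.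
Qed.

Lemma near_eq_uniform_cvg (T : choiceType) (R : realType) (A : set T)
    (f_ : (T -> R)^nat) (f : T -> R) :
  (\forall n \near \oo, {in A, f_ n =1 f}) -> {uniform A, f_ @ \oo --> f}.
Proof.
move=> f_f P /uniform_nbhs[E [entE EP]]; apply: filterS f_f => n f_nf.
by apply: EP => x /mem_set Ax; rewrite f_nf //; exact: entourage_refl.
Qed.

Lemma le_indic (T : Type) (R : realType) (A B : set T) (x : T) :
  A `<=` B -> (\1_A x <= \1_B x :> R)%R.
Proof.
move=> AB; rewrite !indicE ler_nat.
by have [/set_mem/AB/mem_set ->|] := boolP (x \in A).
Qed.

(** The bound passes to the infimum of every late enough tail, and the lower limit is the limit of
    these infima. *)
Lemma limn_einf_ge (R : realType) (u : (\bar R)^nat) (l : \bar R) :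
  (\forall n \near \oo, l <= u n) -> l <= limn_einf u.
Proof.
move=> [N _ lu]; rewrite limn_einf_lim.
apply: lime_ge; first exact: is_cvg_einfs.
exists N => // n Nn; apply: le_ereal_inf_tmp => _ [k /= nk <-].
exact/lu/(leq_trans Nn).
Qed.

Section shilkret.
Context {d : measure_display} {X : measurableType d} {R : realType}.
Variables (mu : set X -> \bar R) (mu_na : nonadditive_measure mu).

Let mu_ge0 A : measurable A -> 0 <= mu A.
Proof. by case: mu_na => _ + _; apply. Qed.

Let mu_le A B : measurable A -> measurable B -> A `<=` B -> mu A <= mu B.
Proof. by case: mu_na => _ _; apply. Qed.

Lemma nonneg_measurable_gt (f : X -> R) (t : R) :
  nonneg_measurable f -> measurable [set x | (t < f x)%R].
Proof.
move=> [mf _].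
rewrite (_ : [set x | _] = setT `&` f @^-1` `]t, +oo[%classic).
  exact: mf.
by apply/seteqP; split => x /=; rewrite in_itv/= andbT => //-[].
Qed.

Lemma nonneg_measurable_indic (A : set X) :
  measurable A -> nonneg_measurable (\1_A : X -> R).
Proof.
by move=> mA; split => [|x]; [exact: measurable_realfun.measurable_indic|rewrite indicE].
Qed.

Lemma shilkret_ge (f : X -> R) (t : R) :
  (0 <= t)%R -> t%:E * mu [set x | (t < f x)%R] <= shilkret mu f.
Proof. by move=> t0; apply: ereal_sup_ubound; exists t. Qed.

Lemma le_shilkret (f g : X -> R) :
  nonneg_measurable f -> nonneg_measurable g ->
  (forall x, (f x <= g x)%R) -> shilkret mu f <= shilkret mu g.
Proof.
move=> mf mg fg; apply: ge_ereal_sup => _ [t /= t0 <-].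
apply: le_trans (shilkret_ge g t0); apply: lee_wpmul2l; first by rewrite lee_fin.
apply: mu_le; [exact: nonneg_measurable_gt..|].
by move=> x /= /lt_le_trans; apply.
Qed.

(** The set where [\1_A] exceeds [t] is [A] for [t] in [[0, 1[] and empty for [t] at least [1], so
    the integral is the supremum of [t * mu A] over [t < 1]. *)
Lemma shilkret_indic (A : set X) : measurable A -> shilkret mu \1_A = mu A.
Proof.
move=> mA; have muA0 := mu_ge0 mA.
apply/eqP; rewrite eq_le; apply/andP; split.
  apply: ge_ereal_sup => _ [t /= t0 <-]; have [t1|t1] := ltP t 1%R.
    rewrite (_ : [set x | _] = A); last first.
      apply/seteqP; split => x /=; rewrite indicE.
        by have [|_] := boolP (x \in A); [rewrite inE|rewrite ltNge t0].
      by move=> /mem_set ->.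
    by rewrite gee_pMl // lee_fin ltW.
  rewrite (_ : [set x | _] = set0).
    by case: mu_na => -> _ _; rewrite mule0.
  rewrite -subset0 => x /=; apply/negP; rewrite -leNgt indicE.
  by rewrite (le_trans _ t1) // lern1 leq_b1.
(* The level [t = 1] contributes [0], so [mu A] is approached through [r * mu A] with [r < 1]; this
   also covers [mu A = +oo]. *)
apply/lee_mul01Pr => // r /andP[r0 r1].
apply: le_trans (shilkret_ge \1_A (ltW r0)).
rewrite (_ : [set x | _] = A) //.
apply/seteqP; split => x /=; rewrite indicE.
  by have [|_] := boolP (x \in A); [rewrite inE|rewrite ltNge ltW].
by move=> /mem_set ->.
Qed.

(* No subadditivity is needed to nest the exceptional sets: uniform convergence
   off finitely many sets is uniform convergence off their intersection. *)
Lemma almost_uniform_cvg_nonincreasing (f_ : (X -> R)^nat) (f : X -> R) :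
  almost_uniform_cvg mu f_ f ->
  exists B : (set X)^nat, [/\ forall k, measurable (B k), nonincreasing_seq B,
    mu (B k) @[k --> \oo] --> 0 & forall k, {uniform ~` B k, f_ @ \oo --> f}].
Proof.
move=> f_f.
have /choice[E HE] k : exists E : set X, [/\ measurable E,
    mu E < (harmonic k : R)%:E & {uniform ~` E, f_ @ \oo --> f}].
  exact/f_f/harmonic_gt0.
have mE k : measurable (E k) by case: (HE k).
(* With [k.+1] factors the last one is [E k], whence [mu (B k) <= mu (E k)], which is below
   [harmonic k]. *)
pose B k := \big[setI/setT]_(i < k.+1) E i.
have mB k : measurable (B k) by apply: bigsetI_measurable.
exists B; split=> //.
- apply/nonincreasing_seqP => k; rewrite subsetEset {1}/B big_ord_recr /=.
  exact: subIsetl.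
- apply: (@squeeze_cvge _ _ _ _ (cst 0) _ (fun k => (harmonic k : R)%:E)).
  + apply: nearW => k; rewrite mu_ge0 //=; case: (HE k) => _ /ltW + _.
    apply: le_trans; apply: mu_le => //.
    by rewrite /B big_ord_recr /=; exact: subIsetr.
  + exact: cvg_cst.
  + exact: cvge_harmonic.
(* Induction on the number of factors; the empty intersection is [setT], whose complement is
   empty. *)
- move=> k; rewrite /B; elim: k.+1 => [|n IHn].
    by rewrite big_ord0 setCT; exact: cvg_uniform_set0.
  rewrite big_ord_recr /= setCI; apply: cvg_uniformU IHn _.
  by case: (HE n).
Qed.

Lemma shilkret_le_limn_einf (f_ : (X -> R)^nat) (f : X -> R) :
  monotone_autocontinuous_from_below mu ->
  (forall n, nonneg_measurable (f_ n)) -> nonneg_measurable f ->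
  almost_uniform_cvg mu f_ f ->
  shilkret mu f <= limn_einf (fun n => shilkret mu (f_ n)).
Proof.
move=> mu_ac mf_ mf /almost_uniform_cvg_nonincreasing[B [mB niB muB f_f]].
apply: ge_ereal_sup => _ [t /= t0 <-]; set A := [set x | _].
have mA : measurable A by exact: nonneg_measurable_gt.
have [->|t_neq0] := eqVneq t 0%R.
  rewrite mul0e; apply: limn_einf_ge; apply: nearW => n.
  apply: le_trans (shilkret_ge (f_ n) (lexx 0%R)).
  by rewrite mul0e.
have {t_neq0}t0 : (0 < t)%R by rewrite lt_neqAle eq_sym t_neq0.
(* Letting [s] tend to [t] is done by scaling: [s = r * t] for arbitrary [r] in []0, 1[]. *)
apply/lee_mul01Pr => [|r /andP[r0 r1]].
  by rewrite mule_ge0 ?mu_ge0 // lee_fin ltW.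
rewrite muleA -EFinM; set s := (r * t)%R.
have s0 : (0 <= s)%R by rewrite mulr_ge0 // ltW.
(* The gap [t - s] is the tolerance for uniform convergence: off [B k], [f x > t] then forces
   [f_ n x > s]. *)
have st : (0 < t - s)%R by rewrite subr_gt0 /s gtr_pMl.
have sA : s%:E * mu (A `\` B k) @[k --> \oo] --> s%:E * mu A.
  by apply: cvgeZl => //; exact: mu_ac.
apply: cvge_le sA; apply: nearW => k; apply: limn_einf_ge.
apply: filterS (uniform_cvg_near_lt (f_f k) st) => n f_nf.
apply: le_trans (shilkret_ge (f_ n) s0); apply: lee_wpmul2l => //.
apply: mu_le; [exact: measurableD|exact: nonneg_measurable_gt|].
move=> x [+ /f_nf] /=; rewrite /A /= ltr_norml => tfx /andP[_ ltf_n].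
by rewrite -(ltrD2l (t - s)) subrK (lt_le_trans tfx) // -lerBlDr ltW.
Qed.

(** The integrals are nondecreasing, so they converge and their lower limit is their limit;
    [f_ n <= f] bounds that limit from above. *)
Lemma increases_to_shilkret (f_ : (X -> R)^nat) (f : X -> R) :
  (forall n, nonneg_measurable (f_ n)) -> nonneg_measurable f ->
  (forall x n, (f_ n x <= f_ n.+1 x <= f x)%R) ->
  shilkret mu f <= limn_einf (fun n => shilkret mu (f_ n)) ->
  increases_to (fun n => shilkret mu (f_ n)) (shilkret mu f).
Proof.
move=> mf_ mf f_f Shf.
have ndSh : nondecreasing_seq (fun n => shilkret mu (f_ n)).
  apply/nondecreasing_seqP => n; apply: le_shilkret => // x.
  by case/andP: (f_f x n).
have cvSh := ereal_nondecreasing_is_cvgn ndSh.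
split => //; rewrite (_ : shilkret mu f = limn (fun n => shilkret mu (f_ n))) //.
apply/eqP; rewrite eq_le -{1}(is_cvg_limn_einfE cvSh) Shf /=.
apply: lime_le => //; apply: nearW => n; apply: le_shilkret => // x.
by have /andP[/le_trans] := f_f x n; apply.
Qed.

(** A single [B k] of small measure serves as exceptional set: for [n >= k], [B n] lies in [B k], so
    off [B k] the two indicators coincide. *)
Lemma almost_uniform_cvg_indicD (A : set X) (B : (set X)^nat) :
  (forall n, measurable (B n)) -> nonincreasing_seq B ->
  mu (B n) @[n --> \oo] --> 0 ->
  almost_uniform_cvg mu (fun n => \1_(A `\` B n) : X -> R) \1_A.
Proof.
move=> mB niB muB e e0.
have muBe : \forall k \near \oo, mu (B k) < e%:E.
  apply: (muB [set x | x < e%:E]); apply: open_nbhs_nbhs.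
  by split; [exact: open_ereal_lt_ereal|rewrite /= lte_fin].
have [k muBk] := filter_ex muBe.
exists (B k); split => //; apply: near_eq_uniform_cvg.
exists k => // n /= kn x /set_mem /= nBkx.
rewrite !indicE in_setD (_ : x \notin B n) ?andbT //.
apply/negP => /set_mem Bnx; apply: nBkx.
by have /subsetPset := niB _ _ kn; apply.
Qed.

End shilkret.

Theorem proposition7p3 (d : measure_display) (X : measurableType d)
    (R : realType) (mu : set X -> \bar R) (mu_na : nonadditive_measure mu) :
  let assertion_i := monotone_autocontinuous_from_below mu in
  let assertion_ii :=
    forall (f_ : (X -> R)^nat) (f : X -> R),
      (forall n, nonneg_measurable (f_ n)) -> nonneg_measurable f ->
      (forall x n, (f_ n x <= f_ n.+1 x <= f x)%R) ->
      almost_uniform_cvg mu f_ f ->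
      increases_to (fun n => shilkret mu (f_ n)) (shilkret mu f) in
  let assertion_iii :=
    forall (f_ : (X -> R)^nat) (f : X -> R),
      (forall n, nonneg_measurable (f_ n)) -> nonneg_measurable f ->
      almost_uniform_cvg mu f_ f ->
      shilkret mu f <= limn_einf (fun n => shilkret mu (f_ n)) in
  (assertion_i <-> assertion_ii) /\ (assertion_ii <-> assertion_iii).
Proof.
move=> i ii iii.
have i_iii : i -> iii by move=> mu_ac f_ f *; exact: shilkret_le_limn_einf.
have iii_ii : iii -> ii.
  by move=> fatou f_ f mf_ mf ? ?; apply: increases_to_shilkret => //; exact: fatou.
have ii_i : ii -> i.
  move=> mct A B mA mB niB muB.
  have mAB n : measurable (A `\` B n) by exact: measurableD.
  rewrite -(shilkret_indic mu_na mA).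
  under eq_fun do rewrite -(shilkret_indic mu_na (mAB _)).
  (* The projection keeps the convergence half of [increases_to]. *)
  apply: (mct (fun n => \1_(A `\` B n)) \1_A _ _ _ _).2.
  - by move=> n; exact: nonneg_measurable_indic.
  - exact: nonneg_measurable_indic.
  - move=> x n; have /subsetPset BnS := niB _ _ (leqnSn n).
    apply/andP; split.
    + by apply: le_indic => y [Ay nBy]; split => // /BnS.
    + by apply: le_indic; exact: subDsetl.
  - exact: almost_uniform_cvg_indicD.
by split; split; auto.
Qed.
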